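(* Let $e\in\mathbb{N}$ and let $(a,b)\in\mathbb{N}^2$ be such that $1\le a\le q-2$ and $0\le b-ea\le q-2$. Let $d_{\mathbb{A},e}(a,b)^\perp$ denote the minimum distance of the dual code $C_{\mathbb{A},e}(a,b)^\perp$. Then $$\min\{a,\,b-ea\}+2\;\le\; d_{\mathbb{A},e}(a,b)^\perp\;\le\;\min\{a,\,b\}+2 .$$
   Context: $q$ is a prime power, $\mathbb{F}_q=\{\alpha_1,\dots,\alpha_q\}$ is the field with $q$ elements, $\mathbb{N}=\{0,1,2,\dots\}$, and $0^0:=1$. The minimum distance of a linear code is the minimal Hamming weight of its nonzero words; duals are taken with respect to the standard (Euclidean) bilinear form. For $a,b\in\mathbb{N}$, let $L_*(aS_e+bF_e)$ be the $\mathbb{F}_q$-span of the monomials $X_1^{d_1}X_2^{d_2}T_1^{c_1}T_2^{c_2}$ with nonnegative exponents satisfying $d_1+d_2=a$ and $c_1+c_2-ed_1=b-ea$. Let $C_e(a,b)\subset\mathbb{F}_q^{(q+1)^2}$ be the set of $(q+1)\times(q+1)$ matrices $\big(f(x_1,x_2,t_1,t_2)\big)$, $f\in L_*(aS_e+bF_e)$, with rows indexed by $(t_1,t_2)$ and columns by $(x_1,x_2)$, each running over $(0,1),(1,\alpha_1),\dots,(1,\alpha_q)$ in this order. The code $C_{\mathbb{A},e}(a,b)\subset\mathbb{F}_q^{q^2}$ is obtained from $C_e(a,b)$ by deleting the first row and the first column of every codeword. *)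

(* Defs.v *)
From HB Require Import structures.
From mathcomp Require Import all_boot all_order all_algebra.
From mathcomp.multinomials Require Import mpoly.

Set Implicit Arguments.
Unset Strict Implicit.
Unset Printing Implicit Defensive.

Import Order.TTheory GRing.Theory Num.Theory.

Local Open Scope ring_scope.

Definition in_span (K : nzRingType) (V : lmodType K) (S : V -> Prop) (v : V)
    : Prop :=
  exists s : seq (K * V),
    (forall kv, kv \in s -> S kv.2) /\ v = \sum_(kv <- s) kv.1 *: kv.2.

(* Words are matrices, so a code is a predicate on matrices. *)
Section Codes.

Variables (F : finFieldType) (m n : nat).
Implicit Types (C : 'M[F]_(m, n) -> Prop) (A B : 'M[F]_(m, n)).

Definition hamming_weight A : nat :=
  #|[set ij : 'I_m * 'I_n | A ij.1 ij.2 != 0]|.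

Definition dual_code C B : Prop :=
  forall A, C A -> \sum_(i < m) \sum_(j < n) A i j * B i j = 0.

(* Fails for every d when C has no nonzero word. *)
Definition is_min_distance C (d : nat) : Prop :=
  (exists A, [/\ C A, A != 0 & hamming_weight A = d]) /\
  (forall A, C A -> A != 0 -> (d <= hamming_weight A)%N).

Lemma is_min_distance_unique C d1 d2 :
  is_min_distance C d1 -> is_min_distance C d2 -> d1 = d2.
Proof.
move=> [[A1 [CA1 nz1 <-]] min1] [[A2 [CA2 nz2 <-]] min2].
by apply/eqP; rewrite eqn_leq min1 // min2.
Qed.

End Codes.

Section HirzebruchCodes.

Variables (F : finFieldType) (q : nat) (alpha : 'I_q -> F) (e a b : nat).

(* The variables X_1, X_2, T_1, T_2 are 'X_0, 'X_1, 'X_2, 'X_3.  The degree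
   condition on T_1, T_2 is stated in int, since b - e * a may be negative. *)
Definition Lstar_monomial (f : {mpoly F[4]}) : Prop :=
  exists d1 d2 c1 c2 : nat,
    [/\ (d1 + d2 = a)%N,
        c1%:Z + c2%:Z - e%:Z * d1%:Z = b%:Z - e%:Z * a%:Z
      & f = 'X_0 ^+ d1 * 'X_1 ^+ d2 * 'X_(2%R) ^+ c1 * 'X_(3%R) ^+ c2].

Definition Lstar : {mpoly F[4]} -> Prop := in_span Lstar_monomial.

(* (0, 1) at index 0, then (1, alpha_1), ..., (1, alpha_q). *)
Definition proj_point (i : 'I_q.+1) : F * F :=
  if unlift ord0 i is Some j then (1, alpha j) else (0, 1).

Definition eval4 (f : {mpoly F[4]}) (x t : F * F) : F :=
  f.@[tnth [tuple x.1; x.2; t.1; t.2]].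

Definition eval_word (f : {mpoly F[4]}) : 'M[F]_q.+1 :=
  \matrix_(i, j) eval4 f (proj_point j) (proj_point i).

Definition hirzebruch_code (M : 'M[F]_q.+1) : Prop :=
  exists2 f, Lstar f & M = eval_word f.

Definition affine_hirzebruch_code (N : 'M[F]_q) : Prop :=
  exists2 M, hirzebruch_code M & N = row' ord0 (col' ord0 M).

End HirzebruchCodes.

(* Main.v *)
Require Import Defs.
From mathcomp Require Import all_boot all_order all_algebra.
From mathcomp.multinomials Require Import mpoly.
From mathcomp Require Import zify.

(** On the affine chart the code is spanned by the words of the monomials
    [x^i t^j] with [i <= a] and [j + e i <= b].  Lower bound: given a point [P]
    of the support of a dual word and at most [min (a, b - e a)] other ones,
    multiply for each other point [Q] a linear form in [x] or in [t] vanishing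
    at [Q] but not at [P]; the product lies in the code and is nonzero at [P]
    only, which contradicts orthogonality.  Upper bound: a linear relation
    between [s + 2] evaluations of polynomials of degree at most [s], placed on
    a line [t = const] with [s = a], or on a line [x = const] with [s = b]. *)

Set Implicit Arguments.
Unset Strict Implicit.
Unset Printing Implicit Defensive.

Import GRing.Theory.

Section DualDistance.

Local Open Scope ring_scope.

(** * Restriction to the affine chart *)

Lemma affine_eval_wordE (F : finFieldType) (q : nat) (alpha : 'I_q -> F)
    (f : {mpoly F[4]}) (k l : 'I_q) :
  row' ord0 (col' ord0 (eval_word alpha f)) k l
  = eval4 f (1, alpha l) (1, alpha k).
Proof. by rewrite !mxE /proj_point !liftK. Qed.

Lemma eval4_monomial (F : finFieldType) (d1 d2 c1 c2 : nat) (x t : F) :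
  eval4 ('X_0 ^+ d1 * 'X_1 ^+ d2 * 'X_(2%R) ^+ c1 * 'X_(3%R) ^+ c2)
    (1, x) (1, t) = x ^+ d2 * t ^+ c2.
Proof.
by rewrite /eval4 !mevalM !rmorphXn /= !mevalXU !(tnth_nth 0) /= !expr1n mul1r mulr1.
Qed.

(** At points [(1, x)], [(1, t)] a monomial keeps only its exponents [i] of [x] and [j] of [t]. The
    degree conditions determine the other two, [a - i] and [b - e * i - j], whose nonnegativity
    gives the bounds on [i] and [j]. *)
Lemma dual_affine_hirzebruchP (F : finFieldType) (q : nat) (alpha : 'I_q -> F)
    (e a b : nat) (B : 'M[F]_q) :
  dual_code (affine_hirzebruch_code alpha e a b) B <->
  (forall i j : nat, (i <= a)%N -> (j + e * i <= b)%N ->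
     \sum_(k < q) \sum_(l < q) alpha l ^+ i * alpha k ^+ j * B k l = 0).
Proof.
split=> [dualB i j le_ia le_jb | orthB A].
  pose f : {mpoly F[4]} := 'X_0 ^+ (a - i) * 'X_1 ^+ i
    * 'X_(2%R) ^+ (b - e * i - j) * 'X_(3%R) ^+ j.
  have Lf : Lstar e a b f.
    exists [:: (1, f)]; split=> [kv|]; last by rewrite big_seq1 scale1r.
    rewrite inE => /eqP-> /=.
    exists (a - i)%N, i, (b - e * i - j)%N, j; split=> //; first by lia.
    have -> : a%:Z = (a - i)%N%:Z + i%:Z by lia.
    have -> : b%:Z = (b - e * i - j)%N%:Z + j%:Z + e%:Z * i%:Z by lia.
    nia.
  rewrite -[RHS](dualB (row' ord0 (col' ord0 (eval_word alpha f)))); last first.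
    by exists (eval_word alpha f) => //; exists f.
  apply: eq_bigr => k _; apply: eq_bigr => l _.
  by rewrite affine_eval_wordE eval4_monomial.
case=> _ [f [s [monS ->]] ->] ->.
(* By linearity in the polynomial it is enough to test each monomial of the combination [s]. *)
transitivity (\sum_(kv <- s) kv.1 * \sum_(k < q) \sum_(l < q)
                eval4 kv.2 (1, alpha l) (1, alpha k) * B k l).
  under [RHS]eq_bigr do rewrite mulr_sumr.
  rewrite [RHS]exchange_big; apply: eq_bigr => k _ /=.
  under [RHS]eq_bigr do rewrite mulr_sumr.
  rewrite [RHS]exchange_big; apply: eq_bigr => l _ /=.
  rewrite affine_eval_wordE /eval4 raddf_sum mulr_suml.
  by apply: eq_bigr => kv _; rewrite /= mevalZ mulrA.
rewrite big_seq big1 // => -[c g] /monS /= [d1 [d2 [c1 [c2 [eq_a eq_b ->]]]]].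
under eq_bigr do under eq_bigr do rewrite eval4_monomial.
by rewrite orthB ?mulr0 //; nia.
Qed.

(** * Lower bound for the weight of dual words *)

Lemma monomial_orthogonal_horner (F : finFieldType) (q : nat)
    (alpha : 'I_q -> F) (m n : nat) (B : 'M[F]_q) (p r : {poly F}) :
    (forall i j : nat, (i <= m)%N -> (j <= n)%N ->
       \sum_(k < q) \sum_(l < q) alpha l ^+ i * alpha k ^+ j * B k l = 0) ->
    (size p <= m.+1)%N -> (size r <= n.+1)%N ->
  \sum_(k < q) \sum_(l < q) p.[alpha l] * r.[alpha k] * B k l = 0.
Proof.
move=> orthB le_p le_r.
transitivity (\sum_(i < m.+1) \sum_(j < n.+1) p`_i * r`_j *
    \sum_(k < q) \sum_(l < q) alpha l ^+ i * alpha k ^+ j * B k l); last first.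
  by rewrite big1 // => i _; rewrite big1 // => j _; rewrite orthB ?mulr0 -1?ltnS.
under [RHS]eq_bigr do under eq_bigr do rewrite mulr_sumr.
under [RHS]eq_bigr do rewrite exchange_big /=.
rewrite [RHS]exchange_big; apply: eq_bigr => k _ /=.
under [RHS]eq_bigr do under eq_bigr do rewrite mulr_sumr.
under [RHS]eq_bigr do rewrite exchange_big /=.
rewrite [RHS]exchange_big; apply: eq_bigr => l _ /=.
rewrite (horner_coef_wide _ le_p) (horner_coef_wide _ le_r) !mulr_suml.
apply: eq_bigr => i _; rewrite mulr_sumr mulr_suml; apply: eq_bigr => j _.
by rewrite mulrACA !mulrA.
Qed.

Lemma monomial_orthogonal_weight (F : finFieldType) (q : nat)
    (alpha : 'I_q -> F) (m n : nat) (B : 'M[F]_q) :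
    injective alpha ->
    (forall i j : nat, (i <= m)%N -> (j <= n)%N ->
       \sum_(k < q) \sum_(l < q) alpha l ^+ i * alpha k ^+ j * B k l = 0) ->
    B != 0 ->
  (minn m n + 2 <= hamming_weight B)%N.
Proof.
move=> inj_alpha orthB nzB; rewrite leqNgt; apply/negP => lt_w.
have [k0 [l0 nzP]] : exists k l, B k l != 0.
  have /matrix0Pn[k [l nz]] := nzB.
  by exists k, l.
pose S := [set kl : 'I_q * 'I_q | B kl.1 kl.2 != 0] :\ (k0, l0).
have card_S : (#|S| <= minn m n)%N.
  have := cardsD1 (k0, l0) [set kl : 'I_q * 'I_q | B kl.1 kl.2 != 0].
  move: lt_w; rewrite /hamming_weight -/S inE nzP /=; lia.
(* A point of [S] outside column [l0] is separated from [(k0, l0)] by [x]. One inside that column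
   lies in another row, so [t] separates it. *)
pose Sx := [set kl in S | kl.2 != l0]; pose St := [set kl in S | kl.2 == l0].
have sub_S (T : {set 'I_q * 'I_q}) : T \subset S -> (#|T| <= minn m n)%N.
  by move=> /subset_leq_card le_T; exact: leq_trans card_S.
have le_x : (#|Sx| <= m)%N.
  apply: leq_trans (geq_minl m n).
  by apply: sub_S; apply/subsetP => kl; rewrite inE => /andP[].
have le_t : (#|St| <= n)%N.
  apply: leq_trans (geq_minr m n).
  by apply: sub_S; apply/subsetP => kl; rewrite inE => /andP[].
pose p := \prod_(kl in Sx) ('X - (alpha kl.2)%:P).
pose r := \prod_(kl in St) ('X - (alpha kl.1)%:P).
have size_p : (size p <= m.+1)%N.
  by rewrite /p -big_enum size_prod_XsubC -cardE ltnS.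
have size_r : (size r <= n.+1)%N.
  by rewrite /r -big_enum size_prod_XsubC -cardE ltnS.
have pE x : p.[x] = \prod_(kl in Sx) (x - alpha kl.2).
  by rewrite horner_prod; apply: eq_bigr => kl _; rewrite hornerXsubC.
have rE t : r.[t] = \prod_(kl in St) (t - alpha kl.1).
  by rewrite horner_prod; apply: eq_bigr => kl _; rewrite hornerXsubC.
have off_P k l : (k, l) != (k0, l0) -> p.[alpha l] * r.[alpha k] * B k l = 0.
  move=> neP; have [->|nz] := eqVneq (B k l) 0; first by rewrite mulr0.
  have kl_S : (k, l) \in S by rewrite 2!inE neP inE.
  have [eq_l|ne_l] := eqVneq l l0.
    have kl_St : (k, l) \in St by rewrite inE kl_S /= eq_l.
    by rewrite rE (bigD1 _ kl_St) /= subrr mul0r mulr0 mul0r.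
  have kl_Sx : (k, l) \in Sx by rewrite inE kl_S.
  by rewrite pE (bigD1 _ kl_Sx) /= subrr !mul0r.
(* By [off_P] the vanishing sum reduces to its term at [(k0, l0)], which is nonzero by injectivity
   of [alpha]. *)
have := monomial_orthogonal_horner orthB size_p size_r.
rewrite (bigD1 k0) //= (bigD1 l0) //= [X in _ + X + _]big1; last first.
  by move=> l ne_l; apply: off_P; apply: contraNneq ne_l => -[->].
rewrite [X in _ + X]big1 ?addr0; last first.
  move=> k ne_k; apply: big1 => l _; apply: off_P.
  by apply: contraNneq ne_k => -[->].
apply/eqP; rewrite !mulf_neq0 // ?pE ?rE; apply/prodf_neq0 => -[k l].
  rewrite inE /= => /andP[_ ne_l].
  by rewrite subr_eq0 (inj_eq inj_alpha) eq_sym.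
rewrite 3!inE /= => /andP[/andP[neP _] /eqP eq_l].
rewrite subr_eq0 (inj_eq inj_alpha); apply: contraNneq neP => ->.
by rewrite eq_l.
Qed.

(** * Dual words of small weight *)

Lemma power_sum_relation (F : finFieldType) (q s : nat) (alpha : 'I_q -> F) :
    (s + 2 <= q)%N ->
  exists v : 'rV[F]_q,
    [/\ v != 0, forall k : 'I_q, (s + 2 <= k)%N -> v 0 k = 0
      & forall j : nat, (j <= s)%N -> \sum_k v 0 k * alpha k ^+ j = 0].
Proof.
move=> le_sq.
(* The columns of index [> s] force the coordinates of index [>= s + 2] to
   vanish; there is one column fewer than rows, hence a kernel. *)
pose M : 'M[F]_(q, q.-1) :=
  \matrix_(k, j) if (j <= s)%N then alpha k ^+ j else (k == j.+1 :> nat)%:R.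
have : kermx M != 0.
  rewrite kermx_eq0 /row_free neq_ltn; apply/orP; left.
  by apply: leq_ltn_trans (rank_leq_col M) _; lia.
case/rowV0Pn => v /sub_kermxP vM0 nz_v; exists v.
have vM j (lt_j : (j < q.-1)%N) :
    \sum_k v 0 k * (if (j <= s)%N then alpha k ^+ j else (k == j.+1 :> nat)%:R)
    = 0.
  have := congr1 (fun A : 'rV_q.-1 => A 0 (Ordinal lt_j)) vM0.
  by rewrite !mxE => {2}<-; apply: eq_bigr => k _; rewrite mxE.
split=> // [k le_k | j le_j]; last first.
  have lt_j : (j < q.-1)%N by lia.
  by have := vM j lt_j; rewrite le_j.
(* Column [k - 1] has index above [s] and is the unit vector with its 1 in row [k], so it gives
   [v 0 k = 0]. *)
have lt_k : (k.-1 < q.-1)%N by have := ltn_ord k; lia.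
have gt_k : (k.-1 <= s)%N = false by lia.
have k_gt0 : (0 < k)%N by lia.
have := vM _ lt_k; rewrite gt_k prednK // (bigD1 k) //= eqxx mulr1.
rewrite big1 ?addr0 // => l ne_l.
by rewrite (inj_eq val_inj) (negPf ne_l) mulr0.
Qed.

Lemma hamming_weight_le_param (F : finFieldType) (q s : nat) (B : 'M[F]_q)
    (g : 'I_s -> 'I_q * 'I_q) :
    (forall k l, B k l != 0 -> exists i, g i = (k, l)) ->
  (hamming_weight B <= s)%N.
Proof.
move=> supp; rewrite -[leqRHS]card_ord -cardsT.
apply: leq_trans (leq_imset_card g _); apply/subset_leq_card/subsetP => -[k l].
by rewrite inE /= => /supp[i <-]; exact: imset_f.
Qed.

(** With the relation placed in a single row, [t] is constant on the support and its power factors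
    out of the sum, so orthogonality holds for every [j]. *)
Lemma row_dual_word (F : finFieldType) (q : nat) (alpha : 'I_q -> F) (m : nat) :
    (m + 2 <= q)%N ->
  exists B : 'M[F]_q,
    [/\ B != 0, (hamming_weight B <= m + 2)%N
      & forall i j : nat, (i <= m)%N ->
          \sum_(k < q) \sum_(l < q) alpha l ^+ i * alpha k ^+ j * B k l = 0].
Proof.
move=> le_mq; have [v [nz_v v0 vsum]] := power_sum_relation alpha le_mq.
have q_gt0 : (0 < q)%N by lia.
pose k0 := Ordinal q_gt0.
exists (\matrix_(k, l) if k == k0 then v 0 l else 0); split.
- apply: contraNneq nz_v => /matrixP B0; apply/eqP/rowP => l.
  by have := B0 k0 l; rewrite !mxE eqxx.
- apply: (@hamming_weight_le_param _ _ _ _ (fun i => (k0, widen_ord le_mq i))).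
  move=> k l; rewrite mxE; have [->|_] := eqVneq k k0; last by rewrite eqxx.
  have [lt_l _|/v0->] := ltnP l (m + 2); last by rewrite eqxx.
  by exists (Ordinal lt_l); congr (_, _); apply: val_inj.
move=> i j le_i; rewrite (bigD1 k0) //= [X in _ + X]big1 ?addr0; last first.
  by move=> k /negPf ne_k; rewrite big1 // => l _; rewrite mxE ne_k mulr0.
transitivity (alpha k0 ^+ j * \sum_l v 0 l * alpha l ^+ i).
  rewrite mulr_sumr; apply: eq_bigr => l _.
  by rewrite mxE eqxx mulrAC mulrC (mulrC (v 0 l)).
by rewrite vsum ?mulr0.
Qed.

Lemma hamming_weight_tr (F : finFieldType) (m n : nat) (B : 'M[F]_(m, n)) :
  hamming_weight B^T = hamming_weight B.
Proof.
pose sw (ij : 'I_m * 'I_n) := (ij.2, ij.1).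
rewrite /hamming_weight -(card_imset _ (_ : injective sw)); last first.
  by move=> [i j] [i' j'] [-> ->].
apply: eq_card => -[j i]; rewrite inE mxE /=; apply/idP/imsetP => [nz|].
  by exists (i, j); rewrite ?inE.
by case=> -[i' j']; rewrite inE /= => nz [-> ->].
Qed.

Lemma dual_affine_hirzebruch_low_weight (F : finFieldType) (q : nat)
    (alpha : 'I_q -> F) (e a b : nat) :
    (minn a b + 2 <= q)%N ->
  exists B : 'M[F]_q, [/\ dual_code (affine_hirzebruch_code alpha e a b) B,
    B != 0 & (hamming_weight B <= minn a b + 2)%N].
Proof.
move=> /(row_dual_word alpha)[B [nzB wB orthB]].
have /orP[le_ab|le_ba] := leq_total a b.
  exists B; split=> //; apply/dual_affine_hirzebruchP => i j le_i _.
  by apply: orthB; rewrite (minn_idPl le_ab).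
(* Transposing exchanges [x] and [t]; the power of [t] is then the one to bound, and [j <= b]
   follows from [j + e * i <= b]. *)
exists B^T; split; rewrite ?hamming_weight_tr //.
  apply/dual_affine_hirzebruchP => i j _ le_j.
  rewrite exchange_big -[RHS](orthB j i); last by lia.
  by apply: eq_bigr => k _; apply: eq_bigr => l _; rewrite mxE (mulrC (_ ^+ i)).
by apply: contra_neq nzB => B0; rewrite -[B]trmxK B0 trmx0.
Qed.

(** * Existence of the minimum distance and conclusion *)

Lemma is_min_distance_exists (F : finFieldType) (m n : nat)
    (C : 'M[F]_(m, n) -> Prop) (P : pred 'M[F]_(m, n)) (A0 : 'M[F]_(m, n)) :
    (forall A, reflect (C A) (P A)) -> C A0 -> A0 != 0 ->
  exists d, is_min_distance C d.
Proof.
move=> CP /CP PA0 nzA0.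
have PA0' : P A0 && (A0 != 0) by rewrite PA0.
case: (arg_minnP (P := fun A => P A && (A != 0)) (@hamming_weight F m n) PA0').
move=> A /andP[/CP CA nzA] minA.
exists (hamming_weight A); split; first by exists A.
by move=> A' /CP PA' nzA'; apply: minA; rewrite PA'.
Qed.

(** Finitely many exponent pairs test duality, which makes it a boolean predicate over which a word
    of least weight can be chosen. *)
Lemma dual_affine_hirzebruch_dec (F : finFieldType) (q : nat)
    (alpha : 'I_q -> F) (e a b : nat) (B : 'M[F]_q) :
  reflect (dual_code (affine_hirzebruch_code alpha e a b) B)
    [forall i : 'I_a.+1, forall j : 'I_b.+1, (j + e * i <= b)%N ==>
      (\sum_(k < q) \sum_(l < q) alpha l ^+ i * alpha k ^+ j * B k l == 0)].
Proof.
apply: (iffP idP) => [orthB | /dual_affine_hirzebruchP orthB].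
  apply/dual_affine_hirzebruchP => i j le_i le_j.
  have lt_i : (i < a.+1)%N by [].
  have lt_j : (j < b.+1)%N by lia.
  move/forallP/(_ (Ordinal lt_i))/forallP/(_ (Ordinal lt_j)): orthB.
  by rewrite /= le_j => /eqP.
apply/forallP => i; apply/forallP => j; apply/implyP => le_j.
by rewrite orthB // -ltnS.
Qed.

End DualDistance.

Theorem theorem3p12 (F : finFieldType) (q : nat) (alpha : 'I_q -> F)
    (cardF : #|F| = q) (alpha_bij : bijective alpha) (e a b : nat)
    (a_ge1 : 1 <= a) (a_le : a <= q - 2)
    (b_ge : e * a <= b) (b_le : b - e * a <= q - 2) :
  exists d : nat,
    [/\ is_min_distance (dual_code (affine_hirzebruch_code alpha e a b)) d,
        minn a (b - e * a) + 2 <= d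
      & d <= minn a b + 2].
Proof.
(* Here [1 <= a <= q - 2] forces [q >= 3], so the subtraction is not truncated. *)
have le_q : minn a b + 2 <= q by lia.
have [B [dualB nzB wB]] := dual_affine_hirzebruch_low_weight alpha e le_q.
have [d min_d] :=
  is_min_distance_exists (dual_affine_hirzebruch_dec alpha e a b) dualB nzB.
exists d; split=> //; last by case: min_d => _ /(_ B dualB nzB) /leq_trans->.
case: min_d => -[A [/dual_affine_hirzebruchP orthA nzA <-]] _.
(* The box [i <= a], [j <= b - e * a] lies in the exponent region of the code, since
   [j + e * i <= j + e * a <= b]. *)
apply: (monomial_orthogonal_weight (bij_inj alpha_bij)) nzA => i j le_i le_j.
by apply: orthA => //; nia.
Qed.
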